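(* Let $N\ge2$, consider $N$ balls of $C$ different colors, with $k_c\ge1$ balls of color $c\in\{1,\dots,C\}$, $\sum_{c}k_c=N$. For every integer $n$ with $1\le n\le N$, let $U_n$ and $V_n$ be the vectors of color counts in a sample of size $n$ drawn without replacement and with replacement, respectively. Then $$D\left(U_n\,\Vert\, V_n\right)\ \ge\ (C-1)\,\frac{n(n-1)}{4(N-1)^2}.$$
   Context: $U_n$ has a multivariate hypergeometric distribution and $V_n$ has the multinomial distribution with $n$ trials and probabilities $p_c=k_c/N$. $D(U_n\Vert V_n)$ denotes the information divergence $D(P\Vert Q)=\sum_i p_i\ln\frac{p_i}{q_i}$ (natural logarithm, $0\ln0=0$) of the distribution $P$ of $U_n$ from the distribution $Q$ of $V_n$. *)

(* Defs.v *)
From HB Require Import structures.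
From mathcomp Require Import all_boot all_order all_algebra.
From mathcomp Require Import all_classical all_reals all_analysis.

Set Implicit Arguments.
Unset Strict Implicit.
Unset Printing Implicit Defensive.

Import Order.TTheory GRing.Theory Num.Theory.
Local Open Scope ring_scope.

(* Each color occurs at most n times in a sample of size n, so the finite type
   {ffun 'I_C -> 'I_n.+1} contains every color-count vector; the mass functions
   below vanish on its elements whose entries do not add up to n. *)

Definition multivariate_hypergeometric_pmf (R : realType) (C : nat)
    (k : 'I_C -> nat) (n : nat) (u : {ffun 'I_C -> 'I_n.+1}) : R :=
  if (\sum_(c < C) u c)%N == n
  then (\prod_(c < C) 'C(k c, u c)%:R) / 'C(\sum_(c < C) k c, n)%:R
  else 0.

Definition multinomial_pmf (R : realType) (C : nat)
    (p : 'I_C -> R) (n : nat) (u : {ffun 'I_C -> 'I_n.+1}) : R :=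
  if (\sum_(c < C) u c)%N == n
  then n`!%:R / (\prod_(c < C) (u c)`!%:R) * \prod_(c < C) p c ^+ u c
  else 0.

(* Extended-real valued: the case split gives 0 ln (0 / q) = 0 and
   p ln (p / 0) = +oo for p != 0, where the library's total division and
   logarithm would make the latter 0. *)
Definition divergence (R : realType) (T : finType) (P Q : T -> R) : \bar R :=
  (\sum_(i : T)
     (if (P i == 0)%R then 0
      else if (Q i == 0)%R then +oo
      else (P i * ln (P i / Q i))%R%:E))%E.

(* Main.v *)
Require Import Defs.
From HB Require Import structures.
From mathcomp Require Import all_boot all_order all_algebra.
From mathcomp Require Import all_classical all_reals all_analysis.
From mathcomp Require Import ring lra zify.

(** Sampling one ball after the other turns the divergence into a sum that can
    be bounded by induction on the sample size.

    Write [N] for the number of balls, [p_c = k_c / N], and [D_n(k)] for the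
    divergence.  All orderings of a sample with given counts are equally likely
    under both schemes, so [D_n(k)] is also the divergence of the ordered
    samples.  Conditioning on the color [c] of the first ball, the other [n]
    balls are drawn without replacement from the urn [k - e_c].  Measured
    against [p] rather than against the proportions of that urn, their
    divergence is [D_n(k - e_c)] plus [n] times the divergence of
    [(k - e_c) / (N - 1)] from [p].  Averaged over [c], the last divergence is
    the mutual information [J(k)] of two balls drawn without replacement, hence
      [D_(n+1)(k) = \sum_c p_c D_n(k - e_c) + n J(k)]
    ([sampling_divergenceS]).

    The chi-square divergence of two draws without replacement from two draws
    with replacement is exactly [(C - 1) / (N - 1)^2].  The inequality
    [J(k) >= (C - 1) / (2 (N - 1)^2)] ([pair_information_ge]) says that the
    divergence is at least half of it.  This follows from the third order Taylor
    polynomial of [x ln x] at 1, which is a lower bound because the fourth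
    derivative is positive: the quadratic terms add up to half the chi-square
    divergence, and the cubic ones to a nonnegative multiple of
    [\sum_c 1 / p_c - 3 C + 2 >= C^2 - 3 C + 2 = (C - 1)(C - 2)].

    A draw may exhaust a color, so the induction has to be over urns with
    varying numbers [C'] of colors present.  It closes because
    [(C' - 1) / (N - 1)^2] does not decrease on average when a ball is drawn
    ([mean_colors_remove_ball]), and because
    [n (n - 1) / 4 + n / 2 = (n + 1) n / 4]. *)

Set Implicit Arguments.
Unset Strict Implicit.
Unset Printing Implicit Defensive.

Import Order.TTheory GRing.Theory Num.Theory.
Import numFieldNormedType.Exports.
Local Open Scope ring_scope.

(** * Urns and count vectors *)

Definition add_ball (C : nat) (d : 'I_C) (u : 'I_C -> nat) : 'I_C -> nat :=
  fun c => (u c + (c == d))%N.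

Definition remove_ball (C : nat) (d : 'I_C) (u : 'I_C -> nat) : 'I_C -> nat :=
  fun c => (u c - (c == d))%N.

Lemma sum_add_ball (C : nat) (d : 'I_C) (u : 'I_C -> nat) :
  (\sum_c add_ball d u c = (\sum_c u c).+1)%N.
Proof.
rewrite /add_ball big_split /= -addn1; congr addn.
by rewrite (bigD1 d) //= eqxx big1 // => c /negbTE->.
Qed.

Lemma remove_ballK (C : nat) (d : 'I_C) (u : 'I_C -> nat) :
  (0 < u d)%N -> add_ball d (remove_ball d u) = u.
Proof.
move=> ud; apply: funext => c; rewrite /add_ball /remove_ball.
by case: eqP => [->|_]; rewrite ?subn0 ?addn0 // subnK.
Qed.

Lemma add_ballK (C : nat) (d : 'I_C) (u : 'I_C -> nat) :
  remove_ball d (add_ball d u) = u.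
Proof. by apply: funext => c; rewrite /add_ball /remove_ball addnK. Qed.

Lemma sum_remove_ball (C : nat) (d : 'I_C) (u : 'I_C -> nat) :
  (0 < u d)%N -> (\sum_c remove_ball d u c = (\sum_c u c).-1)%N.
Proof. by move=> ud; rewrite -{2}(remove_ballK ud) sum_add_ball. Qed.

(** Urns and samples are both functions to [nat], so that moving a ball does not
    change the type; the finite function type serves only to sum over. *)
Definition counts (B C : nat) (u : {ffun 'I_C -> 'I_B.+1}) : 'I_C -> nat :=
  fun c => u c.

(** * Moments of the multivariate hypergeometric distribution *)

Section Hypergeometric.
Variable R : realType.

Definition hypergeom (C : nat) (k : 'I_C -> nat) (n : nat) (u : 'I_C -> nat) : R :=
  if (\sum_c u c)%N == n
  then (\prod_c 'C(k c, u c)%:R) / 'C(\sum_c k c, n)%:R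
  else 0.

(** The sum runs over vectors with entries at most [B], where [B] does not depend
    on the sample size: the recursions on [n] then stay within one finite type.
    For [n <= B] no vector of total [n] is left out. *)
Definition hypergeom_mean (B C : nat) (k : 'I_C -> nat) (n : nat)
    (F : ('I_C -> nat) -> R) : R :=
  \sum_(u : {ffun 'I_C -> 'I_B.+1}) hypergeom k n (counts u) * F (counts u).

(** Size biasing at one point: a factor [u_d] is absorbed by
    [u_d 'C(k_d, u_d) = k_d 'C(k_d - 1, u_d - 1)], here with [u_d = v_d + 1], and
    the denominators are related by the same identity. *)
Lemma hypergeom_add_ball (C : nat) (k : 'I_C -> nat) (n : nat) (d : 'I_C)
    (v : 'I_C -> nat) :
  hypergeom k n.+1 (add_ball d v) * (v d).+1%:R =
  n.+1%:R * ((k d)%:R / (\sum_c k c)%:R) * hypergeom (remove_ball d k) n v.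
Proof.
rewrite /hypergeom sum_add_ball eqSS; case: eqP => _; last by rewrite mul0r mulr0.
have [kd|kd] := posnP (k d).
  rewrite kd mul0r mulr0 mul0r (bigD1 d) //= kd bin_small /add_ball ?eqxx ?addn1 //.
  by rewrite !mul0r.
rewrite sum_remove_ball //; set N := (\sum_c k c)%N.
rewrite (bigD1 d) //= [in RHS](bigD1 d) //=.
have -> : add_ball d v d = (v d).+1 by rewrite /add_ball eqxx addn1.
have -> : remove_ball d k d = (k d).-1 by rewrite /remove_ball eqxx subn1.
rewrite (@eq_bigr _ _ _ _ _ _ _ (fun c => 'C(remove_ball d k c, v c)%:R : R)); last first.
  by move=> c /negbTE cd; rewrite /add_ball /remove_ball cd addn0 subn0.
set X := \prod_(_ | _) _.
have /(congr1 (fun m => m%:R : R)) := mul_bin_diag (k d) (v d).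
have /(congr1 (fun m => m%:R : R)) := mul_bin_diag N n.
rewrite !natrM => eN ek.
have iN : n.+1%:R / (N%:R * 'C(N.-1, n)%:R) = 'C(N, n.+1)%:R^-1 :> R.
  by rewrite eN invfM mulrA mulfV ?mul1r // pnatr_eq0.
rewrite -iN invfM.
transitivity ((v d).+1%:R * 'C(k d, (v d).+1)%:R * X *
   (n.+1%:R * (N%:R^-1 * 'C(N.-1, n)%:R^-1)) : R); first by ring.
by rewrite -ek; ring.
Qed.

(** Weighting by [u_d] amounts to forcing one ball of color [d] into the sample.
    Everything below about the hypergeometric law comes from this identity:
    [F = 1] gives the mean of [u_d], and summing over [d] gives the
    decomposition according to the first ball. *)
Lemma hypergeom_mean_bias (B C : nat) (k : 'I_C -> nat) (n : nat) (d : 'I_C)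
    (F : ('I_C -> nat) -> R) : (n < B)%N ->
  hypergeom_mean B k n.+1 (fun u => (u d)%:R * F u) =
  n.+1%:R * ((k d)%:R / (\sum_c k c)%:R) *
    hypergeom_mean B (remove_ball d k) n (fun v => F (add_ball d v)).
Proof.
move=> nB; rewrite /hypergeom_mean.
pose h (v : {ffun 'I_C -> 'I_B.+1}) : {ffun 'I_C -> 'I_B.+1} :=
  [ffun c => inord (add_ball d (counts v) c)].
pose h' (v : {ffun 'I_C -> 'I_B.+1}) : {ffun 'I_C -> 'I_B.+1} :=
  [ffun c => inord (remove_ball d (counts v) c)].
pose P (v : {ffun 'I_C -> 'I_B.+1}) := (\sum_c v c == n)%N.
have hE v : P v -> counts (h v) = add_ball d (counts v).
  move=> /eqP Pv; apply: funext => c; rewrite /counts /h ffunE inordK // ltnS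
    /add_ball /counts.
  have : (v c <= n)%N by rewrite -Pv (bigD1 c) //= leq_addr.
  by case: (c == d) => /= h1; lia.
have h'E (v : {ffun 'I_C -> 'I_B.+1}) :
    counts (h' v) = remove_ball d (counts v).
  apply: funext => c; rewrite /counts /h' ffunE inordK // /remove_ball /counts.
  by rewrite (leq_ltn_trans (leq_subr _ _)).
have ffunP_nat (u v : {ffun 'I_C -> 'I_B.+1}) :
    counts u = counts v -> u = v.
  by move=> uv; apply/ffunP => c; apply/val_inj; exact: (congr1 (fun f => f c) uv).
(* Only count vectors of total [n + 1] with a ball of color [d] contribute on
   the left, and they are the [h v] for [v] of total [n]; [n < B] ensures that
   [h] does not overflow there. *)
rewrite (bigID (fun u : {ffun 'I_C -> 'I_B.+1} =>
  ((\sum_c u c)%N == n.+1) && (0 < u d)%N)) /=.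
rewrite [X in _ + X]big1 ?addr0; last first.
  move=> u; rewrite negb_and lt0n negbK => /orP[/negbTE su|/eqP ud].
    by rewrite /hypergeom su mul0r.
  by rewrite -[counts u d]/(u d : nat) ud mul0r mulr0.
rewrite [in RHS](bigID P) /= [X in _ * (_ + X)]big1 ?addr0; last first.
  by move=> u /negbTE Pu; rewrite /hypergeom -/(P u) Pu mul0r.
rewrite (reindex_onto h h') /=; last first.
  move=> u /andP[/eqP su ud]; apply: ffunP_nat.
  rewrite hE ?h'E ?remove_ballK //.
  have := @sum_remove_ball _ d (counts u) ud; rewrite su /= -h'E => e.
  by rewrite /P e.
rewrite big_distrr /=.
have PE (v : {ffun 'I_C -> 'I_B.+1}) :
  [&& (\sum_c h v c == n.+1)%N, (0 < h v d)%N & h' (h v) == v] = P v.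
  apply/idP/idP => [/and3P[/eqP s hd /eqP e]|Pv].
    have := @sum_remove_ball _ d (counts (h v)) hd; rewrite s -h'E e /= => sv.
    by rewrite /P sv.
  have e := hE _ Pv.
  have -> : (\sum_c h v c = \sum_c add_ball d (counts v) c)%N by rewrite -e.
  rewrite sum_add_ball (eqP Pv) eqxx /=.
  have -> : (h v d : nat) = add_ball d (counts v) d by rewrite -e.
  rewrite /add_ball eqxx addn1 /=.
  by apply/eqP/ffunP_nat; rewrite h'E e add_ballK.
apply: eq_big => [v|v]; first by rewrite -PE andbA.
rewrite -andbA PE => Pv.
have -> : counts (h v) d = (counts v d).+1.
  by rewrite (hE _ Pv) /add_ball eqxx addn1.
rewrite (hE _ Pv).
by rewrite mulrA hypergeom_add_ball !mulrA.
Qed.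

Lemma hypergeom_mean_sum (B C : nat) (k : 'I_C -> nat) (n : nat) (I : finType)
    (F : I -> ('I_C -> nat) -> R) :
  hypergeom_mean B k n (fun u => \sum_i F i u) = \sum_i hypergeom_mean B k n (F i).
Proof.
rewrite /hypergeom_mean exchange_big /=; apply: eq_bigr => u _.
by rewrite mulr_sumr.
Qed.

Lemma hypergeom_mean_lin (B C : nat) (k : 'I_C -> nat) (n : nat) (a : R)
    (F G : ('I_C -> nat) -> R) :
  hypergeom_mean B k n (fun u => F u + a * G u) =
  hypergeom_mean B k n F + a * hypergeom_mean B k n G.
Proof.
rewrite /hypergeom_mean mulr_sumr -big_split /=; apply: eq_bigr => u _; ring.
Qed.

(** Summing [hypergeom_mean_bias] over [d] multiplies the weight by
    [\sum_d u_d = n + 1]. *)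
Lemma hypergeom_mean_first_draw (B C : nat) (k : 'I_C -> nat) (n : nat)
    (F : ('I_C -> nat) -> R) : (n < B)%N ->
  hypergeom_mean B k n.+1 F =
  \sum_d (k d)%:R / (\sum_c k c)%:R *
    hypergeom_mean B (remove_ball d k) n (fun v => F (add_ball d v)).
Proof.
move=> nB; apply: (@mulfI _ n.+1%:R); first by rewrite pnatr_eq0.
rewrite [RHS]mulr_sumr.
transitivity (\sum_d hypergeom_mean B k n.+1 (fun u => (u d)%:R * F u)); last first.
  by apply: eq_bigr => d _; rewrite mulrA hypergeom_mean_bias.
rewrite -hypergeom_mean_sum /hypergeom_mean mulr_sumr; apply: eq_bigr => u _.
rewrite /hypergeom; case: eqP => [<-|_]; last by rewrite !mul0r mulr0.
by rewrite -mulr_suml natr_sum; ring.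
Qed.

Lemma color_prob_sum1 (C : nat) (k : 'I_C -> nat) :
  (0 < \sum_c k c)%N -> \sum_d (k d)%:R / (\sum_c k c)%:R = 1 :> R.
Proof.
by move=> k0; rewrite -mulr_suml -natr_sum mulfV // pnatr_eq0 -lt0n.
Qed.

Lemma hypergeom_mean1 (B C : nat) (k : 'I_C -> nat) (n : nat) :
  (n <= B)%N -> (n <= \sum_c k c)%N -> hypergeom_mean B k n (fun=> 1) = 1.
Proof.
elim: n k => [|n IHn] k nB nk.
  rewrite /hypergeom_mean (bigD1 [ffun=> ord0]) //= big1 => [|u u0].
    rewrite /hypergeom big1 => [|c _]; last by rewrite /counts ffunE.
    rewrite eqxx big1 => [|c _]; last by rewrite /counts ffunE bin0.
    by rewrite bin0 divr1 mulr1 addr0.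
  rewrite /hypergeom; case: eqP => [/eqP|]; last by rewrite mul0r.
  rewrite sum_nat_eq0 => /forallP s0; case/negP: u0.
  by apply/eqP/ffunP => c; rewrite ffunE; apply/val_inj/eqP; exact: s0.
rewrite hypergeom_mean_first_draw // -[RHS](@color_prob_sum1 _ k); last lia.
apply: eq_bigr => d _; have [->|kd] := posnP (k d); first by rewrite !mul0r.
by rewrite IHn ?mulr1 // ?sum_remove_ball //; lia.
Qed.

Lemma hypergeom_mean_count (B C : nat) (k : 'I_C -> nat) (n : nat) (d : 'I_C) :
  (n <= B)%N -> (n <= \sum_c k c)%N ->
  hypergeom_mean B k n (fun u => (u d)%:R) = n%:R * (k d)%:R / (\sum_c k c)%:R.
Proof.
case: n => [|n] nB nk.
  rewrite !mul0r /hypergeom_mean big1 // => u _; rewrite /hypergeom; case: eqP => [/eqP|].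
    by rewrite sum_nat_eq0 => /forallP /(_ d) /eqP ->; rewrite mulr0.
  by rewrite mul0r.
have -> : hypergeom_mean B k n.+1 (fun u => (u d)%:R) =
          hypergeom_mean B k n.+1 (fun u => (u d)%:R * 1).
  by apply: eq_bigr => u _; rewrite mulr1.
rewrite (hypergeom_mean_bias k d (fun=> 1)) //.
have [->|kd] := posnP (k d); first by rewrite !(mul0r, mulr0).
by rewrite hypergeom_mean1 ?mulr1 ?mulrA // ?sum_remove_ball; lia.
Qed.

End Hypergeometric.

(** * A Taylor lower bound for x ln x *)

(** After division by [x], the difference of the two sides has derivative
    [(x - 1)^3 / (3 x^2)], which has the sign of [x - 1], so its minimum is at 1.
    The inequality extends to [x = 0], with [0 ln 0 = 0]; this case occurs for a
    color with a single ball, which cannot be drawn twice. *)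
Lemma xlnx_ge_taylor3 (R : realType) (x : R) : 0 <= x ->
  (x - 1) + (x - 1) ^+ 2 / 2 - (x - 1) ^+ 3 / 6 <= x * ln x.
Proof.
rewrite le_eqVlt => /orP[/eqP <-|x0]; first by lra.
pose f (y : R) : R := ln y + (y * y + - 6 * y + 3 + 2 * y^-1) / 6.
pose df (y : R) : R := (y - 1) ^+ 3 / (3 * y ^+ 2).
have fd (y : R) : 0 < y -> is_derive y 1 f (df y).
  move=> y0; have yn0 : y != 0 by rewrite gt_eqF.
  have dl := is_derive1_ln y0.
  have dv : is_derive y 1 (fun z : R => z^-1) (- y ^- 2 *: 1).
    exact: (is_deriveV (f := id) yn0 (is_derive_id y 1)).
  (* [f] in the form of function algebra, as the rules of derivation expect. *)
  have -> : f = (@ln R : R -> R) + (6^-1 : R) *: ((id : R -> R) * id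
      + (- 6 : R) *: (id : R -> R) + cst (3 : R) + (2 : R) *: (fun z : R => z^-1)) :> (R -> R).
    apply: funext => z; rewrite /f !fctE /GRing.scale /=; congr (_ + _); exact: mulrC.
  have := is_deriveD dl (is_deriveZ (6^-1 : R) (is_deriveD (is_deriveD (is_deriveD
    (is_deriveM (is_derive_id y 1) (is_derive_id y 1))
    (is_deriveZ (- 6 : R) (is_derive_id y 1)))
    (is_derive_cst (3 : R) y 1)) (is_deriveZ (2 : R) dv))).
  move=> e; apply: (is_derive_eq e).
  rewrite /GRing.scale /= /df; field.
  exact: yn0.
have f1 : f 1 = 0 by rewrite /f ln1; field.
have fx : 0 <= f x.
  have cont (a b : R) : 0 < a -> {within `[a, b], continuous f}%classic.
    move=> a0; apply: derivable_within_continuous => z.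
    rewrite in_itv /= => /andP[az _].
    by have [] := fd z (lt_le_trans a0 az).
  have [x1|x1] := leP 1 x.
    have [y|c] := MVT_segment (df := df) x1 _ (@cont 1 x ltr01).
      by rewrite in_itv /= => /andP[y1 _]; apply: fd; lra.
    rewrite in_itv /= f1 subr0 => /andP[c1 _] ->.
    apply: mulr_ge0; last lra.
    by apply: divr_ge0; [apply: exprn_ge0|apply: mulr_ge0 => //; apply: exprn_ge0]; lra.
  have [y|c] := MVT_segment (df := df) (ltW x1) _ (@cont x 1 x0).
    by rewrite in_itv /= => /andP[y1 _]; apply: fd; lra.
  rewrite in_itv /= f1 => /andP[cx c1] e.
  suff : df c * (1 - x) <= 0 by lra.
  apply: mulr_le0_ge0; last lra.
  rewrite /df exprS -mulrA mulrC; apply: mulr_ge0_le0; last lra.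
  by apply: divr_ge0; [apply: sqr_ge0|apply: mulr_ge0 => //; apply: exprn_ge0]; lra.
rewrite -subr_ge0; suff -> :
    x * ln x - (x - 1 + (x - 1) ^+ 2 / 2 - (x - 1) ^+ 3 / 6) = x * f x.
  by rewrite mulr_ge0 // ltW.
by rewrite /f; field; rewrite gt_eqF.
Qed.

(** * The chain rule for successive draws *)

Section Information.
Variable R : realType.

(** The logarithm of [k ^_ u], written as a sum in order that [ln_ffactS] holds
    for all [k] and [u], including those for which [k ^_ u] is zero. *)
Definition ln_ffact (k u : nat) : R := \sum_(i < u) ln (k - i)%:R.

Lemma ln_ffactS (k u : nat) :
  ln_ffact k u.+1 = ln k%:R + ln_ffact k.-1 u.
Proof.
rewrite /ln_ffact big_ord_recl subn0; congr (_ + _); apply: eq_bigr => i _.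
by rewrite /= /bump leq0n add1n subnS predn_sub.
Qed.

Lemma ln_ffactE (k u : nat) : (u <= k)%N -> ln (k ^_ u)%:R = ln_ffact k u.
Proof.
elim: u k => [|u IHu] k uk; first by rewrite ffactn0 ln1 /ln_ffact big_ord0.
rewrite ffactnS natrM lnM ?posrE ?ltr0n ?ffact_gt0; try lia.
by rewrite IHu ?ln_ffactS //; lia.
Qed.

(** On the support of the hypergeometric law, the logarithm of its ratio to the
    multinomial law.  The factors [n! / \prod_c u_c!] cancel in this ratio, which
    leaves a sum of one term for each color. *)
Definition log_ratio (C : nat) (k : 'I_C -> nat) (n : nat) (u : 'I_C -> nat) : R :=
  \sum_c (ln_ffact (k c) (u c) - (u c)%:R * ln (k c)%:R)
  - (ln_ffact (\sum_c k c) n - n%:R * ln (\sum_c k c)%:R).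

Definition sampling_divergence (B C : nat) (k : 'I_C -> nat) (n : nat) : R :=
  hypergeom_mean B k n (log_ratio k n).

(** The mutual information of two balls drawn without replacement: the mean over
    the color [c] of the first ball of the divergence of [(k - e_c) / (N - 1)]
    from [k / N].  In this divergence only color [c] has a log-ratio different
    from [ln (N / (N - 1))]. *)
Definition pair_information (C : nat) (k : 'I_C -> nat) : R :=
  \sum_c (k c)%:R / (\sum_c k c)%:R *
    ((k c).-1%:R / (\sum_c k c).-1%:R * (ln (k c).-1%:R - ln (k c)%:R)
     + (ln (\sum_c k c)%:R - ln (\sum_c k c).-1%:R)).

Definition colors (C : nat) (k : 'I_C -> nat) : nat := (\sum_c (0 < k c))%N.

(** The first ball, of color [d], has the same probability under both schemes;
    the two added terms come from replacing the proportions [k / N] by those of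
    the remaining urn as reference for the other [n] balls. *)
Lemma log_ratio_add_ball (C : nat) (k : 'I_C -> nat) (n : nat) (d : 'I_C)
    (v : 'I_C -> nat) : (0 < k d)%N ->
  log_ratio k n.+1 (add_ball d v) =
  log_ratio (remove_ball d k) n v
  + (ln (k d).-1%:R - ln (k d)%:R) * (v d)%:R
  + n%:R * (ln (\sum_c k c)%:R - ln (\sum_c k c).-1%:R).
Proof.
move=> kd; rewrite /log_ratio sum_remove_ball //; set N := (\sum_c k c)%N.
rewrite (bigD1 d) //= [in RHS](bigD1 d) //=.
rewrite (@eq_bigr _ _ _ _ _ _ _ (fun c =>
  ln_ffact (remove_ball d k c) (v c) - (v c)%:R * ln (remove_ball d k c)%:R)); last first.
  by move=> c /negbTE cd; rewrite /add_ball /remove_ball cd addn0 subn0.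
have -> : add_ball d v d = (v d).+1 by rewrite /add_ball eqxx addn1.
have -> : remove_ball d k d = (k d).-1 by rewrite /remove_ball eqxx subn1.
rewrite !ln_ffactS -[(v d).+1%:R]natr1 -[n.+1%:R]natr1; ring.
Qed.

(** The chain rule.  By [log_ratio_add_ball] the correction due to the first ball
    is affine in the counts of the others, so only their means are needed. *)
Lemma sampling_divergenceS (B C : nat) (k : 'I_C -> nat) (n : nat) :
  (n < B)%N -> (n < \sum_c k c)%N ->
  sampling_divergence B k n.+1 =
  \sum_d (k d)%:R / (\sum_c k c)%:R * sampling_divergence B (remove_ball d k) n
  + n%:R * pair_information k.
Proof.
move=> nB nN; rewrite /sampling_divergence hypergeom_mean_first_draw //.
rewrite /pair_information [X in _ + X]mulr_sumr -big_split /=; apply: eq_bigr => d _.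
have [->|kd] := posnP (k d); first by rewrite !(mul0r, mulr0) addr0.
have sk := sum_remove_ball kd.
set a := ln (k d).-1%:R - _; set b := ln (\sum_c k c)%:R - _.
have -> : (fun v => log_ratio k n.+1 (add_ball d v)) =
    (fun v => (log_ratio (remove_ball d k) n v + a * (v d)%:R) + n%:R * b * 1).
  by apply: funext => v; rewrite log_ratio_add_ball // mulr1.
rewrite !hypergeom_mean_lin hypergeom_mean_count ?hypergeom_mean1 ?sk; try lia.
have -> : remove_ball d k d = (k d).-1 by rewrite /remove_ball eqxx subn1.
rewrite mulr1; ring.
Qed.

Lemma sampling_divergence0 (B C : nat) (k : 'I_C -> nat) :
  sampling_divergence B k 0 = 0.
Proof.
rewrite /sampling_divergence /hypergeom_mean big1 // => u _; rewrite /hypergeom.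
case: eqP => [/eqP|_]; last by rewrite mul0r.
rewrite sum_nat_eq0 => /forallP u0.
suff -> : log_ratio k 0 (counts u) = 0 by rewrite mulr0.
rewrite /log_ratio big1 => [|c _].
  by rewrite /ln_ffact big_ord0 !(mul0r, subr0).
by move: (u0 c) => /= /eqP ->; rewrite /ln_ffact big_ord0 mul0r subr0.
Qed.

(** Color [k] contributes [p ((1 - p) f ln f + p g ln g)] to the mutual
    information, where [p = k / N], and [f] and [g] are the ratios of the
    probabilities without and with replacement of a second ball of another and
    of the same color.  The Taylor bounds give
    [(1 - p) / (2 (N-1)^2) + (1 / p - 3 + 2 p) / (6 (N-1)^3)].  The bound
    [1 / p >= 2 S - S^2 p], valid for every [S] by [(1 - S p)^2 >= 0], makes it
    affine in [p]; the factor [0 < k] lets it hold also for an absent color. *)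
Lemma pair_information_term_ge (N k : nat) (S : R) :
  (1 < N)%N -> (k <= N)%N ->
  (2 * (N.-1%:R) ^+ 2)^-1 * ((0 < k)%N%:R - k%:R / N%:R)
  + (6 * N.-1%:R ^+ 3)^-1 *
    ((2 * S - 3) * (0 < k)%N%:R + (2 - S ^+ 2) * (k%:R / N%:R)) <=
  k%:R / N%:R * (k.-1%:R / N.-1%:R * (ln k.-1%:R - ln k%:R)
     + (ln N%:R - ln N.-1%:R)) :> R.
Proof.
move=> N1 kN; have [->|k0] := posnP k; first by rewrite !(mul0r, mulr0, subr0, addr0).
have [m km] : exists m, k = m.+1 by exists k.-1; rewrite prednK.
have [M NM] : exists M, N = M.+1 by exists N.-1; rewrite prednK //; lia.
subst k N; rewrite /= mulr1n.
have mM : m%:R <= M%:R :> R by rewrite ler_nat.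
have M0 : 0 < M%:R :> R by rewrite ltr0n.
have m0 : 0 <= m%:R :> R by [].
set f : R := M.+1%:R / M%:R; set g : R := m%:R * M.+1%:R / (m.+1%:R * M%:R).
have f0 : 0 <= f by rewrite divr_ge0.
have g0 : 0 <= g by rewrite divr_ge0 ?mulr_ge0.
have lnf : ln f = ln M.+1%:R - ln M%:R by rewrite ln_div ?posrE ?ltr0n.
have lng : m%:R * ln g = m%:R * (ln m%:R - ln m.+1%:R + ln f) :> R.
  have [->|mp] := posnP m; first by rewrite !mul0r.
  rewrite lnf /g ln_div ?posrE ?mulr_gt0 ?ltr0n // !lnM ?posrE ?ltr0n //; ring.
have Tf := xlnx_ge_taylor3 f0; have Tg := xlnx_ge_taylor3 g0.
set p : R := m.+1%:R / M.+1%:R.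
have p01 : 0 < p <= 1.
  by rewrite divr_gt0 ?ltr0n //= ler_pdivrMr ?ltr0n // mul1r ler_nat.
have pg : p * g = m%:R / M%:R.
  by rewrite /p /g -![_.+1%:R]natr1; field; apply/and3P; split; lra.
have pf : (1 - p) * f = 1 - m%:R / M%:R.
  by rewrite /p /f -![_.+1%:R]natr1; field; lra.
have -> : m%:R / M%:R * (ln m%:R - ln m.+1%:R) + (ln M.+1%:R - ln M%:R)
    = (1 - p) * (f * ln f) + p * (g * ln g) :> R.
  rewrite -lnf [(1 - p) * _]mulrA pf [p * _]mulrA pg.
  rewrite [_ / _ * ln g]mulrAC lng; ring.
have sq : 0 <= (1 - S * p) ^+ 2 / (p * (6 * M%:R ^+ 3)).
  by rewrite divr_ge0 ?sqr_ge0 // !mulr_ge0 ?exprn_ge0 //; lra.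
apply: (le_trans (y := p * ((1 - p) * (f - 1 + (f - 1) ^+ 2 / 2 - (f - 1) ^+ 3 / 6)
   + p * (g - 1 + (g - 1) ^+ 2 / 2 - (g - 1) ^+ 3 / 6)))); last first.
  apply: ler_wpM2l; first lra.
  by apply: lerD; apply: ler_wpM2l => //; lra.
rewrite -subr_ge0; apply: le_trans sq _; rewrite le_eqVlt; apply/orP; left; apply/eqP.
rewrite /p /f /g -![_.+1%:R]natr1; field.
apply/and3P; split; lra.
Qed.

(** The free parameter [S] is taken to be the number of colors present, so that
    the bound on [1 / p] is tight when all the [p_c] are equal.  The cubic terms
    then add up to a multiple of [(S - 1)(S - 2)], nonnegative since [S] is a
    natural number. *)
Lemma pair_information_ge (C : nat) (k : 'I_C -> nat) :
  (1 < \sum_c k c)%N ->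
  ((colors k)%:R - 1) / (2 * (\sum_c k c).-1%:R ^+ 2) <= pair_information k.
Proof.
move=> N1; have p1 := color_prob_sum1 R (ltnW N1).
rewrite /pair_information; set N := (\sum_c k c)%N in N1 p1 *.
set S : R := (colors k)%:R.
apply: (le_trans (y := \sum_c
  ((2 * (N.-1%:R) ^+ 2)^-1 * ((0 < k c)%N%:R - (k c)%:R / N%:R)
  + (6 * N.-1%:R ^+ 3)^-1 *
    ((2 * S - 3) * (0 < k c)%N%:R + (2 - S ^+ 2) * ((k c)%:R / N%:R))))); last first.
  apply: ler_sum => c _; apply: pair_information_term_ge => //.
  by rewrite /N (bigD1 c) //= leq_addr.
have Ssum : \sum_c (0 < k c)%N%:R = S by rewrite /S /colors natr_sum.
rewrite big_split /= -!mulr_sumr big_split /= sumrN Ssum p1.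
rewrite [X in _ <= _ + _ * X]big_split /= -!mulr_sumr Ssum p1 !mulr1.
rewrite mulrC lerDl mulr_ge0 //.
have -> : (2 * S - 3) * S + (2 - S ^+ 2) = (S - 1) * (S - 2) by ring.
rewrite /S; case: (colors k) => [|[|j]].
- by lra.
- by rewrite subrr mul0r.
- by rewrite -!natr1; have : 0 <= j%:R :> R by []; nra.
Qed.

Lemma colors_remove_ball (C : nat) (k : 'I_C -> nat) (d : 'I_C) :
  (0 < k d)%N -> (colors (remove_ball d k) + (k d == 1) = colors k)%N.
Proof.
move=> kd; rewrite /colors (bigD1 d) //= [in RHS](bigD1 d) //= addnAC.
congr (_ + _)%N; first by rewrite /remove_ball eqxx; case: (k d) kd => [|[]].
by apply: eq_bigr => c /negbTE cd; rewrite /remove_ball cd subn0.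
Qed.

(** Only drawing the ball of a color with a single ball loses a color, so the
    mean loss is [s / N] with [s] the number of such colors.  If [s < S], where
    [S] is the number of colors, [S - 1] thus decreases on average by at most a
    fraction [1 / N], and [(N - 1)^2] decreases by a larger one.  Otherwise all
    balls have different colors, [S = N], and the two sides are [1 / (N - 1)] and
    [1 / (N - 2)]. *)
Lemma mean_colors_remove_ball (C : nat) (k : 'I_C -> nat) :
  (2 < \sum_c k c)%N ->
  ((colors k)%:R - 1) / ((\sum_c k c).-1%:R) ^+ 2 <=
  \sum_d (k d)%:R / (\sum_c k c)%:R *
     (((colors (remove_ball d k))%:R - 1) / (\sum_c k c).-2%:R ^+ 2) :> R.
Proof.
move=> N2; have p1 := color_prob_sum1 R (ltnW (ltnW N2)).
set N := (\sum_c k c)%N in N2 p1 *; set S := colors k.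
pose s := (\sum_c (k c == 1))%N.
have sS : (s <= S)%N by apply: leq_sum => c _; case: (k c) => [|[]].
have SN : (S <= N)%N by apply: leq_sum => c _; case: (k c).
(* A form of [N <= S] when [s = S] that can be checked color by color. *)
have NS : (N + s * N <= s + S * N)%N.
  rewrite /s /S /colors !big_distrl /= -!big_split /=.
  apply: leq_sum => c _; have : (k c <= N)%N by rewrite /N (bigD1 c) //= leq_addr.
  by case: (k c) => [|[|j]] /=; lia.
have -> : \sum_d (k d)%:R / N%:R *
     (((colors (remove_ball d k))%:R - 1) / N.-2%:R ^+ 2) =
   (S%:R - 1 - s%:R / N%:R) / N.-2%:R ^+ 2 :> R.
  transitivity (\sum_d ((S%:R - 1) * ((k d)%:R / N%:R) - (k d == 1%N)%:R / N%:R)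
     / N.-2%:R ^+ 2 : R); last first.
    by rewrite -mulr_suml big_split /= -mulr_sumr p1 mulr1 sumrN -mulr_suml -natr_sum.
  apply: eq_bigr => d _; have [->|kd] := posnP (k d).
    by rewrite !(mul0r, mulr0) subr0 mul0r.
  rewrite [S](esym (colors_remove_ball kd)) natrD.
  case: eqP => [->|_] /=; ring.
have [M NM] : exists M, N = M.+3 by exists (N - 3)%N; lia.
rewrite NM /= in sS SN NS *.
rewrite ler_pdivrMr ?exprn_gt0 ?ltr0n // mulrAC ler_pdivlMr ?exprn_gt0 ?ltr0n //.
have key : (s * M.+2 ^ 2 + (2 * M + 3) * M.+3 <= S * ((2 * M + 3) * M.+3))%N.
  have [Ss|Ss] := leqP S s; last by nia.
  have -> : s = S by lia.
  have -> : S = M.+3 by nia.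
  nia.
have {}key : s%:R * (M%:R + 2) ^+ 2 + (2 * M%:R + 3) * (M%:R + 3) <=
    S%:R * ((2 * M%:R + 3) * (M%:R + 3)) :> R.
  move: key; rewrite -(ler_nat R) !(natrD, natrM, natrX).
  by rewrite -[M.+3]addn3 -[M.+2]addn2 !natrD.
have -> : M.+3%:R = M%:R + 3 :> R by rewrite -addn3 natrD.
have -> : M.+2%:R = M%:R + 2 :> R by rewrite -addn2 natrD.
have -> : M.+1%:R = M%:R + 1 :> R by rewrite -addn1 natrD.
have M3 : 0 < M%:R + 3 :> R by rewrite ltr_wpDl.
rewrite -subr_ge0.
have -> : (S%:R - 1 - s%:R / (M%:R + 3)) * (M%:R + 2) ^+ 2 - (S%:R - 1) * (M%:R + 1) ^+ 2
  = (S%:R * ((2 * M%:R + 3) * (M%:R + 3))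
     - (s%:R * (M%:R + 2) ^+ 2 + (2 * M%:R + 3) * (M%:R + 3))) / (M%:R + 3) :> R.
  by field; rewrite gt_eqF.
by rewrite divr_ge0 ?subr_ge0 // ltW.
Qed.

(** The induction needs arbitrary urns, as colors disappear along the draws; in
    the chain rule the two terms contribute [n (n - 1) / 4] and [n / 2]. *)
Lemma sampling_divergence_ge (B C : nat) (k : 'I_C -> nat) (n : nat) :
  (n <= B)%N -> (n <= \sum_c k c)%N ->
  ((colors k)%:R - 1) / (\sum_c k c).-1%:R ^+ 2 * (n%:R * (n%:R - 1) / 4) <=
  sampling_divergence B k n.
Proof.
elim: n k => [|n IHn] k nB nN.
  by rewrite sampling_divergence0 !mul0r mulr0.
rewrite sampling_divergenceS //.
have [->|n0] := posnP n.
  rewrite !(subrr, mulr0, mul0r) addr0 sumr_ge0 // => d _.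
  by rewrite sampling_divergence0 mulr0.
have J := pair_information_ge (leq_ltn_trans n0 nN).
set N := (\sum_c k c)%N in nN J *.
have IH : \sum_d (k d)%:R / N%:R *
    (((colors (remove_ball d k))%:R - 1) / N.-2%:R ^+ 2 * (n%:R * (n%:R - 1) / 4)) <=
    \sum_d (k d)%:R / N%:R * sampling_divergence B (remove_ball d k) n :> R.
  apply: ler_sum => d _; have [->|kd] := posnP (k d); first by rewrite !mul0r.
  apply: ler_wpM2l; first by rewrite divr_ge0.
  have := IHn (remove_ball d k); rewrite sum_remove_ball //; apply; lia.
apply: (le_trans _ (lerD IH (ler_wpM2l (ler0n R n) J))).
(* For [n = 1] the urn may be down to one ball after the draw, and the bound
   from the induction hypothesis is zero. *)
have [->|n1] := eqVneq n 1%N.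
  rewrite big1 ?add0r => [|d _]; last by rewrite subrr !(mulr0, mul0r).
  rewrite le_eqVlt; apply/orP; left; apply/eqP; field.
  by rewrite pnatr_eq0; lia.
have N2 : (2 < N)%N by lia.
have E := mean_colors_remove_ball N2.
have q0 : 0 <= n%:R * (n%:R - 1) / 4 :> R.
  by rewrite divr_ge0 // mulr_ge0 // subr_ge0 ler1n.
under eq_bigr do rewrite [_ / _ * _]mulrA.
rewrite -mulr_suml; apply: (le_trans _ (lerD (ler_wpM2r q0 E) (lexx _))).
rewrite le_eqVlt; apply/orP; left; apply/eqP; rewrite -[n.+1%:R]natr1 -/N; field.
by rewrite pnatr_eq0; lia.
Qed.

End Information.

(** * Comparison with the multinomial distribution *)

Lemma ln_prod (R : realType) (I : finType) (F : I -> R) :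
  (forall i, 0 < F i) -> ln (\prod_i F i) = \sum_i ln (F i).
Proof.
move=> F0.
apply: (proj2 (big_ind2 (fun x y => 0 < x /\ ln x = y) _ _ _)) => //.
- by rewrite ln1.
- move=> x1 x2 y1 y2 [x10 <-] [y10 <-]; split; first exact: mulr_gt0.
  by rewrite lnM.
Qed.

Lemma hypergeometric_multinomial_ratio (R : realType) (C : nat) (k : 'I_C -> nat)
    (n : nat) (p : 'I_C -> R) (u : {ffun 'I_C -> 'I_n.+1}) :
  (forall c, p c != 0) ->
  multivariate_hypergeometric_pmf R k u =
  (\prod_c ((k c ^_ u c)%:R / p c ^+ u c)) / ((\sum_c k c) ^_ n)%:R *
  multinomial_pmf p u.
Proof.
move=> p0; rewrite /multivariate_hypergeometric_pmf /multinomial_pmf.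
case: eqP => _; last by rewrite mulr0.
set N := (\sum_c k c)%N.
have -> : \prod_c ((k c ^_ u c)%:R / p c ^+ u c) =
    (\prod_c 'C(k c, u c)%:R) * (\prod_c (u c)`!%:R) / \prod_c p c ^+ u c :> R.
  rewrite -big_split /= -prodf_div; apply: eq_bigr => c _.
  by rewrite -bin_ffact natrM.
rewrite -bin_ffact natrM invfM.
have f0 : n`!%:R != 0 :> R by rewrite pnatr_eq0 -lt0n fact_gt0.
have U0 : \prod_c (u c)`!%:R != 0 :> R.
  by apply/prodf_neq0 => c _; rewrite pnatr_eq0 -lt0n fact_gt0.
have P0 : \prod_c p c ^+ u c != 0 by apply/prodf_neq0 => c _; rewrite expf_neq0.
set X := \prod_c (u c)`!%:R in U0 *; set Y := \prod_c p c ^+ u c in P0 *.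
set Z := 'C(N, n)%:R^-1; field.
by apply/and3P.
Qed.

(** Since every [k_c] is positive, the multinomial mass of a vector of total [n]
    is positive, and the divergence has no infinite term. *)
Lemma divergence_sampling_divergence (R : realType) (C : nat) (k : 'I_C -> nat)
    (n : nat) : (forall c, 0 < k c)%N -> (0 < \sum_c k c)%N -> (n <= \sum_c k c)%N ->
  divergence (@multivariate_hypergeometric_pmf R C k n)
    (@multinomial_pmf R C (fun c => (k c)%:R / (\sum_c k c)%:R) n)
  = (sampling_divergence R n k n)%:E.
Proof.
move=> k0 N0 nN; rewrite /divergence /sampling_divergence /hypergeom_mean.
set N := (\sum_c k c)%N in N0 nN *.
rewrite -sumEFin; apply: eq_bigr => u _.
rewrite -[hypergeom R k n (counts u)]/(multivariate_hypergeometric_pmf R k u).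
case: eqP => [->|/eqP P0]; first by rewrite mul0r.
have su : (\sum_c u c)%N = n.
  apply/eqP; apply: contraNT P0 => /negbTE su.
  by rewrite /multivariate_hypergeometric_pmf su.
have uk c : (u c <= k c)%N.
  rewrite leqNgt; apply/negP => kc; case/negP: P0.
  rewrite /multivariate_hypergeometric_pmf su eqxx (bigD1 c) //= bin_small //.
  by rewrite !mul0r.
have p0 c : 0 < (k c)%:R / N%:R :> R by rewrite divr_gt0 ?ltr0n.
have pn0 c : (k c)%:R / N%:R != 0 :> R by rewrite gt_eqF.
have Q0 : 0 < multinomial_pmf (fun c => (k c)%:R / N%:R) u :> R.
  rewrite /multinomial_pmf su eqxx; apply: mulr_gt0; last first.
    by apply: prodr_gt0 => c _; exact: exprn_gt0.
  by rewrite divr_gt0 ?prodr_gt0 // => [|c _]; rewrite ltr0n fact_gt0.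
rewrite gt_eqF //; congr (_ * _)%:E.
rewrite (hypergeometric_multinomial_ratio _ _ pn0) mulfK ?gt_eqF // -/N.
have f0 c : 0 < (k c ^_ u c)%:R :> R by rewrite ltr0n ffact_gt0.
rewrite ln_div ?posrE ?prodr_gt0 ?ltr0n ?ffact_gt0 //; last first.
  by move=> c _; rewrite divr_gt0 // exprn_gt0.
rewrite ln_prod => [|c]; last by rewrite divr_gt0 // exprn_gt0.
rewrite /log_ratio -/N (ln_ffactE R nN).
transitivity (\sum_c (ln_ffact R (k c) (u c) - (u c)%:R * ln (k c)%:R)
    + \sum_c (u c)%:R * ln N%:R - ln_ffact R N n); last first.
  rewrite -mulr_suml -natr_sum su /counts; ring.
congr (_ - _); rewrite -big_split /=; apply: eq_bigr => c _.
rewrite ln_div ?posrE ?exprn_gt0 // ln_ffactE // lnXn // ln_div ?posrE ?ltr0n //.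
by rewrite -mulr_natl; ring.
Qed.

Theorem theorem4p3 (R : realType) (N C : nat) (k : 'I_C -> nat)
    (hN : (2 <= N)%N)
    (hk : forall c : 'I_C, (1 <= k c)%N)
    (hsum : (\sum_(c < C) k c)%N = N) :
  forall n : nat, (1 <= n)%N -> (n <= N)%N ->
    (((C%:R - 1) * ((n%:R * (n%:R - 1)) / (4 * (N%:R - 1) ^+ 2)))%R%:E
     <= divergence (@multivariate_hypergeometric_pmf R C k n)
                   (@multinomial_pmf R C (fun c => (k c)%:R / N%:R)%R n))%E.
Proof.
move=> n n1 nN; rewrite -hsum in hN nN *.
rewrite divergence_sampling_divergence ?(ltnW hN) // lee_fin.
have := @sampling_divergence_ge R n C k n (leqnn n) nN.
have -> : colors k = C.
  rewrite /colors (eq_bigr (fun=> 1%N)) => [|c _]; last by rewrite hk.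
  by rewrite sum1_card card_ord.
have -> : (\sum_c k c).-1%:R = (\sum_c k c)%:R - 1 :> R by rewrite -subn1 natrB // ltnW.
apply: le_trans; rewrite le_eqVlt; apply/orP; left; apply/eqP.
by rewrite invfM; ring.
Qed.
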